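(* Let $(X,d)$ be a compact metric space and let $\phi$ be a continuous flow on $X$. Then the set $Sh(\phi)$ of shadowable points of $\phi$ is a $G_\delta$ subset of $X$ (a countable intersection of open subsets of $X$).
   Context: A flow on $X$ is a map $\phi:X\times\mathbb{R}\to X$ with $\phi(x,0)=x$ and $\phi(\phi(x,s),t)=\phi(x,s+t)$, assumed continuous; $\phi_t(x)=\phi(x,t)$. Given $\delta,T>0$, a $(\delta,T)$-pseudo-orbit is a sequence $(x_i,t_i)_{i\in\mathbb{Z}}$ in $X\times\mathbb{R}$ with $t_i\ge T$ and $d(\phi_{t_i}(x_i),x_{i+1})\le\delta$ for all $i\in\mathbb{Z}$. It passes through $p$ if $x_0=p$. Put $s_0=0$, $s_i=\sum_{j=0}^{i-1}t_j$ for $i>0$, $s_i=-\sum_{j=i}^{-1}t_j$ for $i<0$, and $x_0\star t=\phi_{t-s_i}(x_i)$ whenever $s_i\le t<s_{i+1}$. $\mathrm{Rep}$ is the set of surjective strictly increasing maps $h:\mathbb{R}\to\mathbb{R}$ with $h(0)=0$. The pseudo-orbit is $\varepsilon$-shadowed if there are $y\in X$ and $h\in\mathrm{Rep}$ with $d(x_0\star t,\phi_{h(t)}(y))\le\varepsilon$ for all $t\in\mathbb{R}$. A point $p\in X$ is shadowable if for every $\varepsilon>0$ there is $\delta>0$ such that every $(\delta,1)$-pseudo-orbit passing through $p$ is $\varepsilon$-shadowed; $Sh(\phi)$ is the set of shadowable points. *)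

(* Defs.v *)
From mathcomp Require Import all_boot all_order all_algebra.
From mathcomp Require Import all_classical all_reals.
From mathcomp Require Import topology normedtype borel_hierarchy.

Set Implicit Arguments.
Unset Strict Implicit.
Unset Printing Implicit Defensive.

Import Order.TTheory GRing.Theory Num.Theory.
Import numFieldNormedType.Exports.

Local Open Scope classical_set_scope.
Local Open Scope ring_scope.

Section Shadowing.
Context {R : realType} {X : metricType R}.
Implicit Types (phi : X * R -> X) (x : int -> X) (t : int -> R) (i : int).

Definition continuous_flow phi : Prop :=
  [/\ continuous phi,
      forall p, phi (p, 0) = p &
      forall p s r, phi (phi (p, s), r) = phi (p, s + r)].

(* A sequence (x_i, t_i) indexed by the integers is a pair of functions. *)
Definition pseudo_orbit phi (delta T : R) x t : Prop :=
  forall i, T <= t i /\ mdist (phi (x i, t i)) (x (i + 1)) <= delta.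

(* [Negz n] is the integer - (n + 1), so its branch is
   - (t_(-1) + t_(-2) + ... + t_(-(n+1))). *)
Definition jump_time t i : R :=
  match i with
  | Posz n => \sum_(j < n) t (Posz j)
  | Negz n => - \sum_(j < n.+1) t (Negz j)
  end.

(* The point x_0 * r. When all t_i are at least some T > 0, there is exactly
   one i with s_i <= r < s_(i+1); the default index 0 of [xget] is then never
   used. *)
Definition orbit_at phi x t (r : R) : X :=
  let i := xget 0 [set i | jump_time t i <= r < jump_time t (i + 1)] in
  phi (x i, r - jump_time t i).

Definition Rep : set (R -> R) :=
  [set h | [/\ set_surj [set: R] [set: R] h,
               {homo h : a b / a < b} & h 0 = 0]].

Definition shadowed phi (eps : R) x t : Prop :=
  exists y : X, exists2 h, Rep h &
    forall r, mdist (orbit_at phi x t r) (phi (y, h r)) <= eps.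

Definition Sh phi : set X :=
  [set p | forall eps, 0 < eps -> exists2 delta : R, 0 < delta &
     forall x t, pseudo_orbit phi delta 1 x t -> x 0 = p ->
       shadowed phi eps x t].

Lemma jump_timeS t i : jump_time t (i + 1) = jump_time t i + t i.
Proof.
case: i => n; first by rewrite -PoszD addn1 /= big_ord_recr.
have -> : Negz n + 1 = - n%:Z by rewrite NegzE -addn1 PoszD opprD; exact: subrK.
case: n => [|n]; first by rewrite /= big_ord0 big_ord1 addNr.
by rewrite -NegzE /= [in RHS]big_ord_recr /= opprD subrK.
Qed.

Lemma jump_time_homo t T : 0 < T -> (forall i, T <= t i) ->
  {homo jump_time t : i j / i <= j}.
Proof.
move=> T0 tT i j ij; have -> : j = i + `|j - i|%N.
  by rewrite gez0_abs ?subr_ge0// subrKC.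
elim: `|j - i|%N => [|n IH]; first by rewrite addr0.
by rewrite -addn1 PoszD addrA jump_timeS ler_wpDr// (le_trans (ltW T0)).
Qed.

Lemma orbit_atE phi x t T i r : 0 < T -> (forall j, T <= t j) ->
  jump_time t i <= r < jump_time t (i + 1) ->
  orbit_at phi x t r = phi (x i, r - jump_time t i).
Proof.
move=> T0 tT ir; rewrite /orbit_at (@xget_unique _ _ _ i)// => j /andP[jr rj].
have {ir} /andP[ir ri] := ir.
have lt_index k l : jump_time t k <= r -> r < jump_time t (l + 1) -> k <= l.
  move=> kr rl; rewrite leNgt; apply/negP; rewrite -lezD1.
  move=> /(jump_time_homo T0 tT); apply/negP.
  by rewrite -ltNge (le_lt_trans kr).
by apply/eqP; rewrite eq_le !lt_index.
Qed.

End Shadowing.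

(* Main.v *)
Require Import Defs.
From mathcomp Require Import all_boot all_order all_algebra.
From mathcomp Require Import all_classical all_reals.
From mathcomp Require Import topology normedtype borel_hierarchy.
From mathcomp Require Import interval_inference lra.
Import Order.TTheory GRing.Theory Num.Theory.
Import numFieldNormedType.Exports.
Local Open Scope classical_set_scope.
Local Open Scope ring_scope.

(** Let [Sh_at phi eps] be the set of points that satisfy the definition of
    shadowability for the single constant [eps], so that [Sh phi] is the
    intersection of the sets [Sh_at phi eps] over [eps > 0]. Doubling
    [eps] makes up for a possible lack of openness: each point of
    [Sh_at phi eps] is interior to [Sh_at phi (eps + eps)] ([near_Sh_at]). As [Sh_at] is monotone in [eps],
    it follows that [Sh phi] is the intersection of the interiors of the sets
    [Sh_at phi (n + 1)^-1], hence a countable intersection of open sets.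

    For the interior property, let [p] lie in [Sh_at phi eps] with constant
    [delta], let [q] be near [p], and take a [(delta / 2, 1)]-pseudo-orbit
    through [q]. Put [p] in place of its point of index 0: this gives a
    [(delta, 1)]-pseudo-orbit through [p], whose shadowing orbit follows the
    original one within [eps + eps], as soon as the orbits of [p] and [q] stay
    close during the whole time [t 0] before the next jump. Continuity alone
    gives this only on a bounded time interval ([near_flow_segment]), and [t 0]
    is not bounded. When [t 0 > 2], however, a fictitious jump of size 0 can
    be inserted at time 1 ([insert_pseudo_orbit], [orbit_at_insert]). The
    curve traced by the pseudo-orbit is unchanged, all times stay at least 1,
    and the time at index 0 becomes 1, so [t 0 <= 2] can be assumed. *)

(** * Jump times *)

Lemma NegzS_add1 n : Negz n.+1 + 1 = Negz n.
Proof. by rewrite !NegzE -[in LHS]addn1 PoszD opprD subrK. Qed.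

Section JumpTime.
Context {R : realType}.
Implicit Types (t : int -> R) (T r : R).

Lemma jump_time_addn t T i n : (forall j, T <= t j) ->
  jump_time t i + T *+ n <= jump_time t (i + n%:Z).
Proof.
move=> tT; elim: n => [|n IH]; first by rewrite mulr0n !addr0.
rewrite -addn1 PoszD [i + _]addrA jump_timeS addn1 mulrSr addrA.
exact: lerD.
Qed.

(** The jump times tend to infinity in both directions, so the intervals
    between them cover the line: the default index in [orbit_at] never
    occurs. *)
Lemma jump_interval_exists t T r : 0 < T -> (forall j, T <= t j) ->
  exists i, jump_time t i <= r < jump_time t (i + 1).
Proof.
move=> T0 tT.
have [m rm] : exists m : nat, `|r| < T *+ m.
  exists (Num.truncn (`|r| / T)).+1.
  by rewrite -mulr_natr mulrC -ltr_pdivrMr// truncnS_gt.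
have lo : jump_time t (- m%:Z) <= r.
  have := jump_time_addn t T (- m%:Z) m tT; rewrite addNr /= big_ord0.
  by move: rm; rewrite ltr_norml => /andP[? ?]; lra.
have ex : exists n : nat, r < jump_time t (- m%:Z + n%:Z).
  exists (m + m)%N; rewrite PoszD addrA addNr add0r.
  have := jump_time_addn t T 0 m tT; rewrite add0r [jump_time t 0]/= big_ord0.
  by move: rm; rewrite ltr_norml => /andP[? ?]; lra.
have [[|n] rn min_n] := ex_minnP ex.
  by move: rn; rewrite addr0 ltNge lo.
exists (- m%:Z + n%:Z); rewrite -addrA -PoszD addn1 rn andbT leNgt.
by apply/negP => /min_n; rewrite ltnn.
Qed.

End JumpTime.

(** * Inserting a fictitious jump *)

(** The entry of index 0 is replaced by the two entries [a], [b]; what follows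
    is shifted by one and what precedes stays in place. *)
Definition insert {A : Type} (u : int -> A) (a b : A) (i : int) : A :=
  match i with
  | Posz 0 => a
  | Posz 1 => b
  | Posz n.+2 => u n.+1
  | Negz _ => u i
  end.

Section Insert.
Context {R : realType} {X : metricType R} (phi : X * R -> X).
Hypothesis phi_flow : continuous_flow phi.
Variables (x : int -> X) (t : int -> R).

Let x' := insert x (x 0) (phi (x 0, 1)).
Let t' := insert t 1 (t 0 - 1).

(** Both pieces of the cut segment must have length at least 1, whence the
    lower bound on [t 0]. *)
Lemma insert_pseudo_orbit delta : 0 < delta -> 2 <= t 0 ->
  pseudo_orbit phi delta 1 x t -> pseudo_orbit phi delta 1 x' t'.
Proof.
move=> d0 t2 xt; have [_ _ phiD] := phi_flow.
case=> [[|[|n]]|[|n]].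
- by split=> //; rewrite /x' /t' /= mdistxx ltW.
- split; first by rewrite /t' /=; lra.
  have [_] := xt 0; rewrite /x' /t' /= phiD.
  by rewrite [1 + _]addrC subrK.
- by have := xt n.+1; rewrite /x' /t' -!PoszD !addn1.
- exact: xt (Negz 0).
- by have := xt (Negz n.+1); rewrite NegzS_add1.
Qed.

Lemma jump_time_insert_pos n :
  jump_time t' (Posz n.+2) = jump_time t (Posz n.+1).
Proof. by rewrite /= !big_ord_recl /t' /= addrA [1 + _]addrC subrK. Qed.

Lemma jump_time_insert1 : jump_time t' 1 = 1.
Proof. by rewrite /= big_ord1. Qed.

Lemma jump_time_insert_neg n : jump_time t' (Negz n) = jump_time t (Negz n).
Proof. by []. Qed.

Lemma orbit_at_insert r : 2 <= t 0 -> (forall i, 1 <= t i) ->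
  orbit_at phi x' t' r = orbit_at phi x t r.
Proof.
move=> t2 t1; have [_ _ phiD] := phi_flow.
have t'1 i : 1 <= t' i by case: i => [[|[|n]]|n]; rewrite /t' //=; lra.
have [i ir] := jump_interval_exists t' 1 r ltr01 t'1.
rewrite (orbit_atE _ _ ltr01 t'1 ir).
have jt1 : jump_time t 1 = t 0 by rewrite /= big_ord1.
have j0 (u : int -> R) : jump_time u 0 = 0 by rewrite /= big_ord0.
(* The new indices 0 and 1 both stand for the old index 0. *)
case: i ir => [[|[|n]]|[|n]].
- rewrite add0r jump_time_insert1 j0 => r01.
  rewrite (@orbit_atE _ _ _ _ _ 1 0)// ?j0// add0r jt1.
  by move/andP: r01 => [-> ?]; lra.
- rewrite jump_timeS jump_time_insert1 => r1.
  have r0 : jump_time t 0 <= r < jump_time t (0 + 1).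
    rewrite add0r j0 jt1; move: r1; rewrite /t' /= => /andP[? ?].
    by apply/andP; split; lra.
  rewrite (orbit_atE _ _ ltr01 t1 r0) j0 /x' /= phiD.
  by rewrite subr0 [1 + _]addrC subrK.
- rewrite -PoszD addn1 !jump_time_insert_pos => rn.
  by rewrite (@orbit_atE _ _ _ _ _ 1 n.+1)// -PoszD addn1.
- have -> : Negz 0 + 1 = 0 by [].
  rewrite jump_time_insert_neg !j0 => rn.
  by rewrite (@orbit_atE _ _ _ _ _ 1 (Negz 0))// ?j0.
- rewrite NegzS_add1 !jump_time_insert_neg => rn.
  by rewrite (@orbit_atE _ _ _ _ _ 1 (Negz n.+1))// NegzS_add1.
Qed.

End Insert.

(** * Moving the base point *)

Section Perturbation.
Context {R : realType} {X : metricType R} (phi : X * R -> X).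

(** This is the tube lemma around [{p}] times the compact segment. *)
Lemma near_flow_segment (p : X) (a b e : R) : continuous phi -> 0 < e ->
  \forall q \near p, forall s, a <= s <= b ->
    mdist (phi (p, s)) (phi (q, s)) < e.
Proof.
move=> phic e0; have e2 : 0 < e / 2 by lra.
have /compact_near_coveringP cov := @segment_compact R a b.
have tube : \forall q \near p, `[a, b] `<=`
    [set s | mdist (phi (p, s)) (phi (q, s)) < e].
  apply: (cov X (nbhs p)
    (fun q s => mdist (phi (p, s)) (phi (q, s)) < e)) => r _.
  have /metricType_numDomainType.cvgrPdist_lt/(_ _ e2) := phic (p, r).
  case=> -[A B] /= [Ap Br] AB; exists (B, A) => //= -[s q] /= [Bs Aq].
  have := AB (q, s) (conj Aq Bs).
  have := AB (p, s) (conj (nbhs_singleton Ap) Bs).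
  rewrite /= => H1 H2.
  rewrite (le_lt_trans (metric_triangle _ (phi (p, r)) _))//.
  by rewrite [mdist _ (phi (p, r))]metric_sym; lra.
by apply: filterS tube => q pq s sab; apply: pq; rewrite /= in_itv.
Qed.


(** Half of [delta] pays for the jumps of the given pseudo-orbit, the other
    half for moving the point of index 0: at [s = 0] this affects the jump into
    that point, at [s = t 0] the jump out of it. The bound 2 on [t 0] is the
    least that leaves only segments that can be cut in two of length at
    least 1. *)
Lemma replace_base_point (p : X) (e delta : R) x t :
  let x' := fun i => if i == 0 then p else x i in
  (forall p, phi (p, 0) = p) ->
  (forall s, 0 <= s <= 2 ->
    mdist (phi (p, s)) (phi (x 0, s)) < Num.min e (delta / 2)) ->
  t 0 <= 2 -> pseudo_orbit phi (delta / 2) 1 x t ->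
  pseudo_orbit phi delta 1 x' t /\
  forall r, mdist (orbit_at phi x t r) (orbit_at phi x' t r) <= e.
Proof.
move=> x' phi0 close t2 xt.
have t1 i : 1 <= t i by case: (xt i).
have [pe pd] : (forall s, 0 <= s <= 2 ->
     mdist (phi (p, s)) (phi (x 0, s)) < e) /\
   (forall s, 0 <= s <= 2 ->
     mdist (phi (p, s)) (phi (x 0, s)) < delta / 2).
  by split=> s /close; rewrite lt_min => /andP[].
have px0 : mdist p (x 0) < delta / 2.
  by have := pd 0; rewrite !phi0; apply; rewrite lexx ler0n.
have d0 : 0 < delta / 2 by rewrite (le_lt_trans _ px0)// mdist_ge0.
split=> [i|r].
  have [ti xi] := xt i; split=> //; rewrite /x'.
  case: (eqVneq i 0) => [i0|_].
    rewrite i0 add0r /=; rewrite i0 add0r in xi.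
    rewrite (le_trans (metric_triangle _ (phi (x 0, t 0)) _))//.
    have : mdist (phi (p, t 0)) (phi (x 0, t 0)) < delta / 2.
      by apply: pd; rewrite t2 (le_trans ler01).
    by lra.
  case: (eqVneq (i + 1) 0) => [i0|_]; last by lra.
  rewrite i0 in xi; rewrite (le_trans (metric_triangle _ (x 0) _))//.
  by rewrite [mdist (x 0) p]metric_sym; lra.
have [i ir] := jump_interval_exists t 1 r ltr01 t1.
rewrite !(orbit_atE _ _ ltr01 t1 ir) /x'.
have e0 : 0 < e.
  by rewrite (le_lt_trans _ (pe 0 _))// ?mdist_ge0// lexx ler0n.
case: (eqVneq i 0) => [i0|_]; last by rewrite mdistxx ltW.
rewrite metric_sym i0 ltW// pe//.
move: ir; rewrite i0 jump_timeS /= big_ord0 => /andP[? ?].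
by apply/andP; split; lra.
Qed.

Definition Sh_at (eps : R) : set X :=
  [set p | exists2 delta : R, 0 < delta &
     forall x t, pseudo_orbit phi delta 1 x t -> x 0 = p ->
       shadowed phi eps x t].

Lemma Sh_at_le eps1 eps2 : eps1 <= eps2 -> Sh_at eps1 `<=` Sh_at eps2.
Proof.
move=> le12 p [delta d0 sh]; exists delta => // x t xt xp.
have [y [h hRep yh]] := sh x t xt xp.
by exists y, h => // r; rewrite (le_trans (yh r)).
Qed.

Lemma near_Sh_at eps p : continuous_flow phi -> 0 < eps -> Sh_at eps p ->
  \forall q \near p, Sh_at (eps + eps) q.
Proof.
move=> phi_flow e0 [delta d0 sh]; have [phic phi0 _] := phi_flow.
have m0 : 0 < Num.min eps (delta / 2) by rewrite lt_min e0 divr_gt0.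
apply: filterS (near_flow_segment p 0 2 _ phic m0) => q pq.
have d2 : 0 < delta / 2 by rewrite divr_gt0.
exists (delta / 2) => // x t xt xq.
have short (u : int -> X) (s : int -> R) : u 0 = q -> s 0 <= 2 -> pseudo_orbit phi (delta / 2) 1 u s ->
    shadowed phi (eps + eps) u s.
  move=> uq s2 us; rewrite -uq in pq.
  have [ps us_ps] := replace_base_point p eps delta u s phi0 pq s2 us.
  have [y [h hRep yh]] := sh _ _ ps erefl.
  exists y, h => // r.
  exact: le_trans (metric_triangle _ _ _) (lerD (us_ps r) (yh r)).
have [t2|t2] := leP (t 0) 2; first exact: short.
have le12 : (1 : R) <= 2 by rewrite ler1n.
have [y [h hRep yh]] := short _ _ xq le12
  (insert_pseudo_orbit phi phi_flow x t _ d2 (ltW t2) xt).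
exists y, h => // r; have := yh r; rewrite orbit_at_insert//; first exact: ltW.
by move=> i; case: (xt i).
Qed.

End Perturbation.

Theorem theorem2p9 (R : realType) (X : metricType R) (phi : X * R -> X) :
  compact [set: X] -> continuous_flow phi -> Gdelta (Sh phi).
Proof.
move=> _ phi_flow; exists (fun n => (Sh_at phi n.+1%:R^-1)°) => [n|].
  exact: open_interior.
apply/seteqP; split=> [p pSh n _|p pSh eps e0].
  have n0 : 0 < n.+1%:R^-1 / 2 :> R by rewrite divr_gt0// invr_gt0.
  by have := near_Sh_at phi _ _ phi_flow n0 (pSh _ n0); rewrite -splitr.
have [n _ /(_ n (leqnn n)) ne] := near_infty_natSinv_lt (PosNum e0).
exact: Sh_at_le (ltW ne) _ (interior_subset (pSh n I)).
Qed.
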